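(* For every positive integer $n$, let $H(n)$ be the number, up to isomorphism, of complete simple games on $n$ voters having exactly two classes of equally desirable voters. Then $$H(n) = F(n+6) - (n^2+4n+8),$$ where $F(m)$ denotes the $m$-th Fibonacci number.
   Context: A simple game is a pair $(N,W)$ with $N=\{1,\dots,n\}$ and $W$ a family of subsets of $N$ (the winning coalitions) such that $N\in W$, $\emptyset\notin W$, and if $S\in W$ and $S\subseteq T\subseteq N$ then $T\in W$. For voters $i,j$, $i$ is more desirable than $j$ ($i\succsim j$) if for every $S\subseteq N\setminus\{i,j\}$, $S\cup\{j\}\in W$ implies $S\cup\{i\}\in W$; $i$ and $j$ are equally desirable ($i\approx j$) if for every $S\subseteq N\setminus\{i,j\}$, $S\cup\{i\}\in W \iff S\cup\{j\}\in W$. The game is complete if $\succsim$ is a complete preorder on $N$; its classes are the equivalence classes of $\approx$, and ''two classes'' means $N=N_1\cup N_2$ with $N_1,N_2$ nonempty, every voter of $N_1$ strictly more desirable than every voter of $N_2$. Two simple games $(N,W)$ and $(N',W')$ are isomorphic if there is a bijection $f:N\to N'$ with $S\in W \iff f(S)\in W'$. Fibonacci numbers: $F(0)=0$, $F(1)=1$, $F(m)=F(m-1)+F(m-2)$ for $m>1$. *)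

(* Defs.v *)
From mathcomp Require Import all_boot all_fingroup all_algebra.

Set Implicit Arguments.
Unset Strict Implicit.
Unset Printing Implicit Defensive.

Section SimpleGames.

Variable T : finType.

Implicit Types (W : {set {set T}}) (i j : T) (S : {set T}).

Definition simple_game W : bool :=
  [&& [set: T] \in W, set0 \notin W &
      [forall S : {set T}, forall S' : {set T},
         (S \in W) && (S \subset S') ==> (S' \in W)]].

Definition more_desirable W i j : bool :=
  [forall S : {set T}, (S \subset ~: [set i; j]) ==>
     ((S :|: [set j] \in W) ==> (S :|: [set i] \in W))].

Definition strictly_more_desirable W i j : bool :=
  more_desirable W i j && ~~ more_desirable W j i.

Definition equally_desirable W i j : bool :=
  [forall S : {set T}, (S \subset ~: [set i; j]) ==>
     ((S :|: [set i] \in W) == (S :|: [set j] \in W))].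

Definition complete_preorder (r : rel T) : bool :=
  [&& [forall i, r i i],
      [forall i, forall j, forall k, r i j && r j k ==> r i k] &
      [forall i, forall j, r i j || r j i]].

Definition complete_simple_game W : bool :=
  simple_game W && complete_preorder (more_desirable W).

Definition desirability_classes W : {set {set T}} :=
  equivalence_partition (equally_desirable W) [set: T].

Definition has_two_classes W : bool :=
  [exists N1 : {set T}, exists N2 : {set T},
    [&& desirability_classes W == [set N1; N2],
        N1 :|: N2 == [set: T], N1 != set0, N2 != set0 &
        [forall i in N1, forall j in N2, strictly_more_desirable W i j]]].

Definition isomorphic_games W W' : bool :=
  [exists f : {perm T}, forall S : {set T}, (S \in W) == (f @: S \in W')].

Lemma isomorphic_games_equiv : equivalence_rel isomorphic_games.
Proof.
apply/equivalence_relP; split=> [W|W1 W2].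
  by apply/existsP; exists 1%g; apply/forallP=> S; rewrite (imset_perm1 S).
have sym V V' : isomorphic_games V V' -> isomorphic_games V' V.
  case/existsP=> f /forallP isof; apply/existsP; exists (f^-1)%g.
  apply/forallP=> S; rewrite (eqP (isof _)) -imset_comp.
  by rewrite (eq_imset _ (permKV f)) imset_id.
have trans V1 V2 V3 : isomorphic_games V1 V2 -> isomorphic_games V2 V3 ->
    isomorphic_games V1 V3.
  case/existsP=> f /forallP isof /existsP[g /forallP isog].
  apply/existsP; exists (f * g)%g; apply/forallP=> S.
  rewrite (eqP (isof _)) (eqP (isog _)) -imset_comp.
  by rewrite (eq_imset _ (permM f g)).
by move=> W12 W; apply/idP/idP; apply: trans => //; apply: sym.
Qed.

End SimpleGames.

Definition num_two_class_games (n : nat) : nat :=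
  #|equivalence_partition (@isomorphic_games 'I_n)
      [set W : {set {set 'I_n}} |
         complete_simple_game W && has_two_classes W]|.

Fixpoint fib (m : nat) : nat :=
  match m with
  | 0 => 0
  | 1 => 1
  | (p.+1 as q).+1 => fib q + fib p
  end.

(* Main.v *)
Require Import Defs.
From mathcomp Require Import all_boot all_fingroup all_algebra zify.

(** A complete game with classes [A] (strong) and [~: A] (weak), of sizes [k] and
    [b], is determined by [k] and the function [f] sending [a <= k] to the least
    number [f a <= b] of weak voters that wins together with [a] strong ones, with
    [f a = b + 1] if there is none.  Since a strong voter can replace a weak one,
    [f a <= b] forces [f (a + 1) <= f a - 1] (truncated), and the two classes are
    distinct iff [f (a + 1) + 2 <= f a] for some [a]; conversely every such [f]
    arises, and isomorphic games have the same [k] and [f].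

    Let [e m b] be the number of sequences of length [m] over [0 .. b + 1] obeying
    the first condition.  Exactly [k + b + 2] of those of length [k + 1] violate
    the second one, so [H n] is the sum of [e (k + 1) (n - k) - (n + 2)] over
    [0 < k < n].  The numbers [e] satisfy Pascal's rule
    [e (m + 1) (b + 1) = e (m + 1) b + e m b], so their antidiagonal sums satisfy
    a perturbed Fibonacci recurrence. *)

Set Implicit Arguments.
Unset Strict Implicit.
Unset Printing Implicit Defensive.

(* The thresholds of consecutive rows; [b.+1] stands for infinity, hence the
   guard [x <= b]. *)
Definition shift_step (b x y : nat) : bool := (x <= b) ==> (y <= x.-1).

(* Sequences all of whose steps are tight describe the symmetric quota games, in
   which strong and weak voters are equally desirable. *)
Definition tight_step (b x y : nat) : bool := shift_step b x y && (x <= y.+1).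

(** * Enumerating words over a finite alphabet *)

Fixpoint words (q m : nat) : seq (seq nat) :=
  if m is m'.+1 then [seq y :: s | y <- iota 0 q, s <- words q m'] else [:: [::]].

Lemma mem_words q m s : (s \in words q m) = (size s == m) && all (gtn q) s.
Proof.
elim: m s => [|m IH] [|x s] //=.
  by apply/allpairsP=> -[[y t] [_ _]].
rewrite eqSS andbCA -IH; apply/allpairsP/andP => [[[y t] /= [Hy Ht [-> ->]]]|[xq sw]].
  by move: Hy; rewrite mem_iota.
by exists (x, s); rewrite mem_iota.
Qed.

Lemma words_uniq q m : uniq (words q m).
Proof.
elim: m => //= m IH; apply: allpairs_uniq => //; first exact: iota_uniq.
by move=> [x s] [y t] _ _ /= [-> ->].
Qed.

Lemma count_words p q m :
  count p (words q m.+1) = \sum_(y < q) count (fun s => p (nat_of_ord y :: s)) (words q m).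
Proof.
rewrite /= count_flatten -map_comp sumnE big_map -{1}[q]subn0 -/(index_iota 0 q) big_mkord.
by apply: eq_bigr => y _ /=; rewrite count_map.
Qed.

Lemma count_words_path (r : rel nat) q m x :
  count (path r x) (words q m.+1) =
  \sum_(y < q | r x y) count (path r y) (words q m).
Proof.
rewrite count_words [RHS]big_mkcond; apply: eq_bigr => y _ /=.
by case: (r x y) => //=; elim: (words q m).
Qed.

(** * Recursive counts, Pascal's rule and Fibonacci sums *)

Fixpoint descents (m x : nat) : nat :=
  if m is m'.+1 then \sum_(y < x.-1.+1) descents m' y else 1.

(** This is [e m b], split on the first letter. After the infinite letter [b.+1] the rest is
    unconstrained. After a finite letter [y] there are [descents m' y] continuations, independently
    of [b] because infinity cannot come back; summing over [y <= b] gives [descents m b.+1]. *)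
Fixpoint shift_words (m b : nat) : nat :=
  if m is m'.+1 then shift_words m' b + descents m b.+1 else 1.

Lemma descents_small m : (descents m 0 = 1) * (descents m 1 = 1).
Proof. by elim: m => //= m [IH _]; rewrite !big_ord1 IH. Qed.

(** Splits off the largest next letter; the offset [x.+2] keeps clear of the truncated predecessor
    at 0. *)
Lemma descentsS m x :
  descents m.+1 x.+2 = descents m.+1 x.+1 + descents m x.+1.
Proof. by rewrite /= [LHS]big_ord_recr. Qed.

Lemma shift_words0 m : shift_words m 0 = m.+1.
Proof. by elim: m => //= m ->; rewrite big_ord1 descents_small addn1. Qed.

Lemma shift_words1 b : shift_words 1 b = b.+2.
Proof. by rewrite /= sum1_card card_ord add1n. Qed.

Local Arguments shift_words : simpl never.

(** By induction on [m]: [descentsS] splits the summand [descents m.+2 b.+2], and its two parts turn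
    the two terms of the induction hypothesis into [shift_words m.+2 b] and [shift_words m.+1 b]. *)
Lemma shift_wordsS m b :
  shift_words m.+1 b.+1 = shift_words m.+1 b + shift_words m b.
Proof.
elim: m => [|m IH]; first by rewrite !shift_words1 addn1.
rewrite -[LHS]/(shift_words m.+1 b.+1 + descents m.+2 b.+2).
rewrite -[shift_words m.+2 b]/(shift_words m.+1 b + descents m.+2 b.+1).
rewrite IH descentsS -[shift_words m.+1 b]/(shift_words m b + descents m.+1 b.+1).
lia.
Qed.

(** With D(N) the antidiagonal sum, Pascal's rule on the inner terms and the boundary values 1 and N
    + 3 give D(N+2) = D(N+1) + D(N) + N + 3. Adding N + 4 to D(N) absorbs the perturbation, with
    initial values 5 and 8. *)
Lemma sum_shift_words N :
  \sum_(m < N.+1) shift_words m (N - m) + N + 4 = fib (N + 5).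
Proof.
suff: \sum_(m < N.+1) shift_words m (N - m) + N + 4 = fib (N + 5) /\
      \sum_(m < N.+2) shift_words m (N.+1 - m) + N.+1 + 4 = fib (N.+1 + 5) by case.
elim: N => [|N [IH1 IH2]].
  by rewrite !big_ord_recl !big_ord0 /= !shift_words0.
split=> //.
have -> : fib (N.+2 + 5) = fib (N.+1 + 5) + fib (N + 5) by rewrite !addSn.
rewrite -{}IH1 -{}IH2 big_ord_recl big_ord_recr /=.
rewrite [in RHS]big_ord_recl /=.
have -> : \sum_(i < N.+1) shift_words (bump 0 i) (N.+2 - bump 0 i) =
  \sum_(i < N.+1) shift_words i.+1 (N - i) + \sum_(i < N.+1) shift_words i (N - i).
  rewrite -big_split; apply: eq_bigr => i _.
  by rewrite /bump add1n subSS subSn ?shift_wordsS // -ltnS.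
have -> : \sum_(i < N.+1) shift_words (bump 0 i) (N.+1 - bump 0 i) =
  \sum_(i < N.+1) shift_words i.+1 (N - i).
  by apply: eq_bigr => i _; rewrite /bump /= add1n subSS.
rewrite subnn shift_words0.
have S0 b : shift_words 0 b = 1 by [].
rewrite !S0 /bump leq0n; set x := \sum_(i < _) _; set y := \sum_(i < _) _; lia.
Qed.

(** * Counting shift words, tight words and profiles *)

Lemma count_shift_path b m x : x <= b ->
  count (path (shift_step b) x) (words b.+2 m) = descents m x.
Proof.
elim: m x => [|m IH] x xb //.
rewrite count_words_path /= /shift_step xb /=.
rewrite (big_ord_widen _ (fun y => descents m y) (_ : x.-1.+1 <= b.+2)); last by lia.
by apply: eq_bigr => y yx; rewrite IH //; lia.
Qed.

Lemma count_shift_words b m :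
  count (sorted (shift_step b)) (words b.+2 m) = shift_words m b.
Proof.
case: m => // m; rewrite count_words /=.
have lastE k : \sum_(y < b.+2) count (path (shift_step b) y) (words b.+2 k) =
   descents k.+1 b.+1 + count (path (shift_step b) b.+1) (words b.+2 k).
  rewrite big_ord_recr /=; congr (_ + _).
  by apply: eq_bigr => y _; rewrite count_shift_path // -ltnS.
rewrite lastE addnC -[RHS]/(shift_words m b + descents m.+1 b.+1); congr (_ + _).
(* From [b.+1] the guard of [shift_step] fails, so the next letter is arbitrary and [lastE] applies
   again. *)
elim: m => [|m IH] //.
rewrite count_words_path -[RHS]/(shift_words m b + descents m.+1 b.+1) -IH addnC -lastE.
by apply: eq_bigl => y; rewrite /shift_step ltnn.
Qed.

(** The upper and lower bounds on the next letter meet at [x.-1], so the continuation is forced. *)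
Lemma count_tight_path b m x : x <= b ->
  count (path (tight_step b) x) (words b.+2 m) = 1.
Proof.
elim: m x => [|m IH] x xb //.
rewrite count_words_path.
have x'b : x.-1 < b.+2 by lia.
rewrite (big_pred1 (Ordinal x'b)) /=; first by rewrite IH //; lia.
by move=> y /=; rewrite -val_eqE /tight_step /shift_step /= xb /=; lia.
Qed.

(** From infinity one may stay or move to [b], after which everything is forced; only the moment of
    leaving, if any, is free. *)
Lemma count_tight_path_top b m :
  count (path (tight_step b) b.+1) (words b.+2 m) = m.+1.
Proof.
elim: m => [|m IH] //.
rewrite count_words_path big_mkcond big_ord_recr big_ord_recr /= IH.
rewrite count_tight_path // /tight_step /shift_step !ltnn !leqnn leqnSn /=.
rewrite big1 // => y _; case: ifP => //; have := ltn_ord y; lia.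
Qed.

Lemma count_tight_words b m :
  count (sorted (tight_step b)) (words b.+2 m.+1) = m + b + 2.
Proof.
rewrite count_words /= big_ord_recr /= count_tight_path_top.
rewrite (eq_bigr (fun=> 1)) ?sum1_card ?card_ord; first by lia.
by move=> y _; apply: count_tight_path; rewrite -ltnS.
Qed.

Definition profiles (k b : nat) : seq (seq nat) :=
  [seq s <- words b.+2 k.+1 |
     sorted (shift_step b) s && ~~ sorted (tight_step b) s].

Lemma size_profiles k b :
  size (profiles k b) + (k + b + 2) = shift_words k.+1 b.
Proof.
rewrite size_filter -count_shift_words -count_tight_words.
elim: (words _ _) => //= s t IH.
have : sorted (tight_step b) s -> sorted (shift_step b) s.
  by apply: sub_sorted => x y /andP[].
case: (sorted (tight_step b) s) (sorted (shift_step b) s) => [] [] //= H; try lia.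
Qed.

Lemma sum_size_profiles n : 0 < n ->
  \sum_(1 <= k < n) size (profiles k (n - k)) + (n ^ 2 + 4 * n + 8) = fib (n + 6).
Proof.
case: n => // n _.
(* In terms of the original n, this is the antidiagonal of index n + 1. Its terms m = k + 1 with 0 <
   k < n give the profiles, each with an excess n + 2. The terms m = 0, 1, n + 1 contribute 1, n +
   2, n + 2; with the correction n + 5 these add up to the quadratic. *)
have := sum_shift_words n.+2; rewrite (addSnnS n.+1 5) => <-.
rewrite big_ord_recl big_ord_recr big_ord_recl /= subnn.
rewrite /bump !leq0n !add1n shift_words1 shift_words0.
rewrite big_add1 /= big_mkord.
have -> : \sum_(i < n) shift_words (1 + (1 + i)) (n.+2 - (1 + (1 + i))) =
          \sum_(i < n) (size (profiles i.+1 (n.+1 - i.+1)) + n.+3).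
  apply: eq_bigr => i _; rewrite !add1n !subSS -size_profiles.
  by have := ltn_ord i; lia.
rewrite big_split /= sum_nat_const card_ord. nia.
Qed.

(** * Classes counted by representatives; subsets and permutations *)

Lemma card_equivalence_partition (T : finType) (X : eqType) (R : rel T)
    (D : {set T}) (L : seq X) (g : X -> T) :
  equivalence_rel R -> uniq L -> {in L, forall x, g x \in D} ->
  {in D, forall w, exists2 x, x \in L & R w (g x)} ->
  {in L &, forall x y, R (g x) (g y) -> x = y} ->
  #|equivalence_partition R D| = size L.
Proof.
move=> eqR uL gD surj inj.
have Rxx x : R x x by have [] := eqR x x x.
have RE x y z : R x y -> R x z = R y z by have [_] := eqR x y z.
pose P x := [set y in D | R (g x) y].
(* [P x] is the class of [g x]; inequivalent representatives have distinct classes. *)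
have uP : uniq (map P L).
  rewrite map_inj_in_uniq // => x y xL yL Pxy; apply: inj => //.
  by have /setP/(_ (g y)) := Pxy; rewrite !inE (gD y yL) Rxx.
rewrite -(size_map P) -(card_uniqP uP); apply: eq_card => B.
apply/imsetP/mapP => [[w wD ->]|[x xL ->]]; last by exists (g x) => //; apply: gD.
have [x xL wx] := surj w wD; exists x => //.
by apply/setP=> y; rewrite !inE (RE _ _ _ wx).
Qed.

Lemma exists_subset_card (T : finType) (B : {set T}) m :
  m <= #|B| -> exists2 C : {set T}, C \subset B & #|C| = m.
Proof.
move=> mB; exists [set x in take m (enum B)].
  by apply/subsetP=> x; rewrite inE => /mem_take; rewrite mem_enum.
rewrite cardsE (card_uniqP _) ?take_uniq ?enum_uniq //.
by rewrite size_takel // -cardE.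
Qed.

Lemma perm_imsetD (T : finType) (p : {perm T}) (S A : {set T}) :
  p @: (S :\: A) = p @: S :\: p @: A.
Proof.
apply/setP=> x; rewrite -[x](permKV p) inE !mem_imset ?inE //; exact: perm_inj.
Qed.

(** The permutation sends a voter to its position in a list of [A] followed by its complement. *)
Lemma exists_perm_initial n (A : {set 'I_n}) :
  exists p : {perm 'I_n}, forall i, (p i < #|A|) = (i \in A).
Proof.
pose e := enum A ++ enum (~: A).
have ine i : i \in e by rewrite mem_cat !mem_enum in_setC orbN.
have sze : size e = n by rewrite size_cat -!cardE cardsC card_ord.
have lt i : index i e < n by rewrite -[X in _ < X]sze index_mem.
have inj : injective (fun i => Ordinal (lt i)).
  by move=> i j [] /(congr1 (nth i e)); rewrite !nth_index.
exists (perm inj) => i; rewrite permE /= index_cat cardE mem_enum.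
case: ifP => iA; first by rewrite index_mem mem_enum.
by rewrite ltnNge leq_addr.
Qed.

(** Only arguments up to [k] are constrained, so [nth 0 s] qualifies whatever its default value. *)
Record shift_profile (k b : nat) (f : nat -> nat) : Prop := ShiftProfile {
  shift_profile_bound : forall a, a <= k -> f a <= b.+1;
  shift_profile_step : forall a, a < k -> f a <= b -> f a.+1 <= (f a).-1;
  shift_profile_drop : exists2 a, a < k & (f a.+1).+1 < f a
}.

(** * From threshold functions to two-class games *)

Section ProfileGames.

Variable T : finType.
Implicit Types (A S : {set T}) (W : {set {set T}}) (f : nat -> nat) (i j : T).

Definition profile_game A f : {set {set T}} :=
  [set S | f #|S :&: A| <= #|S :\: A|].

Lemma exists_profile A a c : a <= #|A| -> c <= #|~: A| ->
  exists S, #|S :&: A| = a /\ #|S :\: A| = c.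
Proof.
move=> /exists_subset_card[B BA <-] /exists_subset_card[C CA <-].
exists (B :|: C); split; apply: eq_card => x; rewrite !inE;
  have := subsetP BA x; have := subsetP CA x; rewrite inE;
  by case: (x \in A) (x \in B) (x \in C) => [] [] [] // H1 H2;
     (have := H1 isT) || (have := H2 isT).
Qed.

Lemma profile_setU1 A S i : i \notin S ->
  (#|(S :|: [set i]) :&: A| = (i \in A) + #|S :&: A|) *
  (#|(S :|: [set i]) :\: A| = (i \notin A) + #|S :\: A|).
Proof.
move=> iS; case: (boolP (i \in A)) => iA /=; split.
- rewrite setIUl (_ : [set i] :&: A = [set i]); last by apply/setIidPl; rewrite sub1set.
  by rewrite setUC cardsU1 inE (negPf iS).
- by rewrite setDUl (eqP (_ : [set i] :\: A == set0)) ?setU0 // setD_eq0 sub1set.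
- rewrite setIUl (_ : [set i] :&: A = set0) ?setU0 //.
  by apply/setP=> x; rewrite !inE; case: eqP => // ->; rewrite (negPf iA).
- rewrite setDUl (_ : [set i] :\: A = [set i]) 1?setUC ?cardsU1 ?inE ?(negPf iS) ?andbF //.
  by apply/setP=> x; rewrite !inE; case: eqP => [->|]; rewrite ?iA ?andbF.
Qed.

Lemma more_desirableP W i j :
  reflect (forall S, i \notin S -> j \notin S ->
             S :|: [set j] \in W -> S :|: [set i] \in W)
          (more_desirable W i j).
Proof.
have subE S : (S \subset ~: [set i; j]) = (i \notin S) && (j \notin S).
  rewrite -disjoints_subset disjoint_sym disjoints_subset subUset !sub1set.
  by rewrite !in_setC.
apply: (iffP forallP) => [H S iS jS|H S].
  by have := H S; rewrite subE iS jS /= => /implyP.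
by rewrite subE; apply/implyP=> /andP[iS jS]; apply/implyP; apply: H.
Qed.

Lemma equally_desirableE W i j :
  equally_desirable W i j = more_desirable W i j && more_desirable W j i.
Proof.
apply/forallP/andP => [H|[/forallP Hi /forallP Hj] S].
  split; apply/forallP=> S; apply/implyP=> Sij; apply/implyP.
    by have := H S; rewrite Sij => /eqP ->.
  by have := H S; rewrite setUC Sij => /eqP ->.
apply/implyP=> Sij; have := Hi S; have := Hj S.
by rewrite [[set j; i]]setUC Sij /= => /implyP H1 /implyP H2; apply/eqP; apply/idP/idP.
Qed.

Section Valid.

Variables (A : {set T}) (f : nat -> nat).
Hypotheses (A_gt0 : 0 < #|A|) (CA_gt0 : 0 < #|~: A|).
Hypothesis fP : shift_profile #|A| #|~: A| f.
Let W := profile_game A f.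

Lemma shift_profile_anti a a' :
  a <= a' <= #|A| -> f a <= #|~: A| -> f a' <= f a.
Proof.
elim: a' => [|a' IH]; first by case: a.
rewrite leq_eqVlt => /andP[/orP[/eqP -> //|]]; rewrite ltnS => aa' a'A fa.
have H : f a' <= f a by apply: IH => //; rewrite aa' ltnW.
have := shift_profile_step fP a'A (leq_trans H fa).
lia.
Qed.

(** At the drop, [f a.+1] is finite, so the grand coalition wins; [f 0 = 0] would force [f a = 0],
    so the empty one loses. *)
Lemma profile_game_simple : simple_game W.
Proof.
have [a aA drop] := shift_profile_drop fP.
have fa := shift_profile_bound fP (ltnW aA).
apply/and3P; split.
- rewrite inE setTI setTD.
  have := @shift_profile_anti a.+1 #|A|; rewrite aA leqnn => /(_ isT); lia.
- rewrite inE set0I set0D cards0 -ltnNge lt0n; apply/eqP=> f0.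
  have := @shift_profile_anti 0 a; rewrite f0 (ltnW aA) => /(_ isT isT); lia.
- apply/forallP=> S; apply/forallP=> S'; apply/implyP; rewrite !inE.
  case/andP=> SW SS'.
  have h1 : #|S :&: A| <= #|S' :&: A| <= #|A|.
    by rewrite subset_leq_card ?setSI // subset_leq_card ?subsetIr.
  have h2 : #|S :\: A| <= #|S' :\: A| by rewrite subset_leq_card ?setSD.
  have h3 : #|S :\: A| <= #|~: A| by rewrite subset_leq_card // setDE subsetIr.
  have := shift_profile_anti h1 (leq_trans SW h3); lia.
Qed.

Lemma profile_game_desirable i j :
  more_desirable W i j = (i \in A) || (j \notin A).
Proof.
apply/more_desirableP/orP => [H|H S iS jS].
  apply/orP; apply: contraT; rewrite negb_or negbK => /andP[iA jA].
  (* For [i] weak and [j] strong, take [a] strong voters other than [j] and [f a - 2] weak voters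
     other than [i]: the drop makes the addition of [j] win, while adding [i] leaves one weak voter
     too few. *)
  have [a aA drop] := shift_profile_drop fP.
  have fa := shift_profile_bound fP (ltnW aA).
  have : a <= #|A :\ j| by have := cardsD1 j A; rewrite jA; lia.
  case/exists_subset_card => B BA Ba.
  have : f a - 2 <= #|~: A :\ i|.
    by have := cardsD1 i (~: A); rewrite inE iA; lia.
  case/exists_subset_card => C CA Cf.
  have [BA' jB] : B \subset A /\ j \notin B.
    by move: BA; rewrite subsetD1 => /andP.
  have [CA' iC] : C \subset ~: A /\ i \notin C.
    by move: CA; rewrite subsetD1 => /andP.
  have iB : i \notin B by apply: contra iA; apply: subsetP.
  have jC : j \notin C by apply: contraL jA => /(subsetP CA'); rewrite inE.
  have iS : i \notin B :|: C by rewrite inE negb_or iB.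
  have jS : j \notin B :|: C by rewrite inE negb_or jB.
  have SA : #|(B :|: C) :&: A| = a.
    rewrite setIUl (setIidPl BA') (_ : C :&: A = set0) ?setU0 //.
    by apply/disjoint_setI0; rewrite disjoints_subset.
  have SCA : #|(B :|: C) :\: A| = f a - 2.
    rewrite setDUl (_ : B :\: A = set0) ?set0U; last by apply/eqP; rewrite setD_eq0.
    by rewrite setDE (setIidPl CA').
  have := H _ iS jS; rewrite !inE !profile_setU1 // SA SCA jA (negPf iA) /= !add1n !add0n.
  by have h : f a.+1 <= f a - 2; [lia | move/(_ h); lia].
rewrite !inE !profile_setU1 //.
case: (boolP (i \in A)) H => iA; case: (boolP (j \in A)) => jA //=; last by case.
  (* Here [i] is strong and [j] weak. Since [j] is outside [S], the threshold bounded by [fa] is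
     finite and the shift condition applies. *)
  rewrite !add1n !add0n => _ fa.
  have aA : #|S :&: A| < #|A|.
    by apply/proper_card/properP; split; [apply: subsetIr|exists i; rewrite ?inE ?(negPf iS)].
  have cA : #|S :\: A| < #|~: A|.
    apply/proper_card/properP; split; first by rewrite setDE subsetIr.
    by exists j; rewrite !inE ?(negPf jS) ?andbF.
  by have := shift_profile_step fP aA; lia.
Qed.

Lemma profile_game_complete : complete_simple_game W.
Proof.
rewrite /complete_simple_game profile_game_simple /=; apply/and3P; split.
- by apply/forallP=> i; rewrite profile_game_desirable orbN.
- apply/forallP=> i; apply/forallP=> j; apply/forallP=> k.
  by rewrite !profile_game_desirable; do 3!case: (_ \in A).
- apply/forallP=> i; apply/forallP=> j.
  by rewrite !profile_game_desirable; do 2!case: (_ \in A).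
Qed.

Lemma profile_game_two_classes : has_two_classes W.
Proof.
apply/existsP; exists A; apply/existsP; exists (~: A); apply/and5P; split.
- have eqE i : [set j in [set: T] | equally_desirable W i j] =
               if i \in A then A else ~: A.
    apply/setP=> j; rewrite !inE equally_desirableE !profile_game_desirable.
    by case: ifP => iA; rewrite ?inE; case: (j \in A).
  apply/eqP/setP=> B; apply/imsetP/set2P => [[i _ ->]|].
    by rewrite eqE; case: ifP; [left|right].
  have [[i iA] [j jA]] : (exists i, i \in A) /\ (exists j, j \in ~: A).
    by split; apply/card_gt0P.
  case=> ->; first by exists i; [rewrite inE | rewrite eqE iA].
  by exists j; [rewrite inE | rewrite eqE; move: jA; rewrite inE => /negPf ->].
- by rewrite setUCr.
- by rewrite -card_gt0.
- by rewrite -card_gt0.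
- apply/forallP=> i; apply/implyP=> iA; apply/forallP=> j; apply/implyP.
  by rewrite inE /strictly_more_desirable !profile_game_desirable iA => /negPf ->.
Qed.

End Valid.

(** Recasts the partition as the desirability formula that profile games satisfy, the form used to
    recover thresholds. *)
Lemma two_classesP W : has_two_classes W ->
  exists A : {set T}, [/\ 0 < #|A|, 0 < #|~: A| &
    forall i j, more_desirable W i j = (i \in A) || (j \notin A)].
Proof.
case/existsP=> A /existsP[B /and5P[/eqP clE /eqP AB A0 B0 /forallP dom]].
have {}dom i j : i \in A -> j \in B -> strictly_more_desirable W i j.
  by move=> iA jB; have /implyP/(_ iA)/forallP/(_ j)/implyP := dom i; apply.
have BE : B = ~: A.
  apply/setP=> x; rewrite inE; have := in_setT x; rewrite -AB inE.
  case xA: (x \in A) => //= _; apply/negP=> xB.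
  by have := dom x x xA xB; rewrite /strictly_more_desirable andbN.
have eqd i j : (i \in A) = (j \in A) -> more_desirable W i j.
  have cl x : x \in [set y | equally_desirable W x y] /\
      [set y | equally_desirable W x y] \in [set A; B].
    split; first by rewrite inE; apply/forallP=> S; rewrite eqxx implybT.
    rewrite -clE; apply/imsetP; exists x; rewrite ?inE //.
    by apply/setP=> y; rewrite !inE.
  have clxE x : [set y | equally_desirable W x y] = if x \in A then A else B.
    have [xc /set2P[E|E]] := cl x; move: xc; rewrite E ?BE ?inE.
      by move=> ->.
    by move=> /negPf ->.
  move=> ij; have : j \in [set y | equally_desirable W i y].
    by rewrite clxE ij; case: ifP => //; rewrite BE inE => ->.
  by rewrite inE equally_desirableE => /andP[].
exists A; rewrite -BE !card_gt0; split=> // i j.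
case iA: (i \in A) => /=; case jA: (j \in A) => /=.
- by apply: eqd; rewrite iA jA.
- have /andP[-> //] : strictly_more_desirable W i j.
  by apply: dom; rewrite // BE inE jA.
- have /andP[_ /negbTE //] : strictly_more_desirable W j i.
  by apply: dom; rewrite // BE inE iA.
- by apply: eqd; rewrite iA jA.
Qed.

(** * From a two-class game to its threshold function *)

Section Decompose.

Variables (W : {set {set T}}) (A : {set T}).
Hypothesis W_simple : simple_game W.
Hypothesis W_desirable :
  forall i j, more_desirable W i j = (i \in A) || (j \notin A).

Lemma simple_gameS S S' : S \in W -> S \subset S' -> S' \in W.
Proof.
move=> SW SS'; have /and3P[_ _ /forallP/(_ S)/forallP/(_ S')] := W_simple.
by rewrite SW SS'.
Qed.

Lemma winning_exchange S i j : i \in S -> j \notin S ->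
  more_desirable W j i -> S \in W -> (S :\ i) :|: [set j] \in W.
Proof.
move=> iS jS /more_desirableP H SW; apply: H; rewrite ?inE ?eqxx ?(negPf jS) ?andbF //.
by rewrite setUC setD1K.
Qed.

(** By induction on the size of [S :\: S']: a voter of [S] outside [S'] is exchanged for one of [S']
    outside [S] in the same class, which exists because both coalitions meet that class in equally
    many voters. *)
Lemma winning_profile S S' :
  #|S :&: A| = #|S' :&: A| -> #|S :\: A| = #|S' :\: A| -> S \in W -> S' \in W.
Proof.
have [m] := ubnP #|S :\: S'|; elim: m S => // m IH S; rewrite ltnS => Sm cA cD SW.
have [SS'|] := boolP (S \subset S'); first exact: simple_gameS SW SS'.
case/subsetPn=> i iS iS'.
have [j [jS' jS ij]] : exists j, [/\ j \in S', j \notin S & (j \in A) = (i \in A)].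
  pose B := if i \in A then A else ~: A.
  have iB : i \in B by rewrite /B; case: ifP; rewrite ?inE => // ->.
  have cB : #|S :&: B| = #|S' :&: B| by rewrite /B; case: ifP; rewrite -?setDE.
  have : ~~ (S' :&: B \subset S :&: B).
    apply/negP=> sub; have /setP/(_ i) : S' :&: B = S :&: B.
      by apply/eqP; rewrite eqEcard sub cB leqnn.
    by rewrite !inE (negPf iS') iS iB.
  case/subsetPn=> j; rewrite !inE => /andP[jS' jB]; rewrite jB andbT => jS.
  exists j; split=> //; move: jB; rewrite /B; case: ifP => //.
  by rewrite inE => _ /negPf.
pose S1 := S :\ i.
have iS1 : i \notin S1 by rewrite !inE eqxx.
have jS1 : j \notin S1 by rewrite !inE (negPf jS) andbF.
have S1E : S = S1 :|: [set i] by rewrite setUC setD1K.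
apply: (IH (S1 :|: [set j])).
- apply: leq_trans Sm.
  apply/proper_card/properP; split.
    apply/subsetP=> x; rewrite !inE => /andP[xS' /orP[/andP[_ ->]|/eqP xj]].
      by rewrite xS'.
    by move: xS'; rewrite xj jS'.
  exists i; rewrite !inE ?iS ?iS' ?eqxx //=.
  by apply/negP=> /eqP ij'; move: iS'; rewrite ij' jS'.
- by rewrite -cA S1E !profile_setU1 // ij.
- by rewrite -cD S1E !profile_setU1 // ij.
- by apply: winning_exchange => //; rewrite W_desirable ij orbN.
Qed.

(** On failure [find] returns the length [#|~: A|.+1] of the list, exactly the value that stands for
    infinity. *)
Definition min_weak a : nat :=
  find (fun c => [exists S in W, (#|S :&: A| == a) && (#|S :\: A| == c)])
       (iota 0 #|~: A|.+1).

Lemma min_weak_bound a : min_weak a <= #|~: A|.+1.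
Proof. by rewrite -[leqRHS](size_iota 0) find_size. Qed.

Lemma card_setD_le S : #|S :\: A| <= #|~: A|.
Proof. by rewrite subset_leq_card // setDE subsetIr. Qed.

Lemma min_weak_le S : S \in W -> min_weak #|S :&: A| <= #|S :\: A|.
Proof.
move=> SW; rewrite leqNgt; apply/negP=> /(before_find 0).
rewrite nth_iota ?ltnS ?card_setD_le // add0n => /existsP[].
by exists S; rewrite SW !eqxx.
Qed.

Lemma min_weak_ex a : min_weak a <= #|~: A| ->
  exists2 S, S \in W & #|S :&: A| = a /\ #|S :\: A| = min_weak a.
Proof.
rewrite -ltnS => lt; move: (lt); rewrite -[X in _ < X](size_iota 0) -has_find.
move/(nth_find 0); rewrite -/(min_weak a) nth_iota // add0n.
by case/existsP=> S /and3P[SW /eqP ? /eqP ?]; exists S.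
Qed.

(** A coalition reaching its threshold contains one with the same strong voters and exactly the
    threshold number of weak ones; the latter has the profile of a winning coalition. *)
Lemma game_min_weak : W = profile_game A min_weak.
Proof.
apply/setP=> S; rewrite inE; apply/idP/idP; first exact: min_weak_le.
move=> le; have [S0 S0W [S0A S0D]] := min_weak_ex (leq_trans le (card_setD_le S)).
have [C CS Cc] := exists_subset_card le.
have CA : C :&: A = set0.
  apply/disjoint_setI0; rewrite disjoints_subset; apply: subset_trans CS _.
  by rewrite setDE subsetIr.
have subS : (S :&: A) :|: C \subset S.
  by rewrite subUset subsetIl (subset_trans CS) // subsetDl.
apply: simple_gameS subS; apply: winning_profile S0W.
- by rewrite setIUl CA setU0 -setIA setIid S0A.
- rewrite S0D -Cc setDUl setDE -setIA setICr setI0 set0U setDE; congr #|pred_of_set _|.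
  by apply/esym/setIidPl; apply: subset_trans CS _; rewrite setDE subsetIr.
Qed.

Lemma min_weak_shift : 0 < #|A| -> 0 < #|~: A| ->
  shift_profile #|A| #|~: A| min_weak.
Proof.
move=> /card_gt0P[i0 i0A] /card_gt0P[j0]; rewrite inE => j0A.
split=> [a _|a aA fa|]; first exact: min_weak_bound.
  have [S SW [Sa Sc]] := min_weak_ex fa.
  have /subsetPn[i iA iS] : ~~ (A \subset S).
    by apply: contraL aA => /setIidPr AS; rewrite -Sa AS ltnn.
  (* Without weak voters in [S], adding [i] gives threshold 0, the truncated case; otherwise [i]
     replaces a weak [j] and saves one weak voter. *)
  have [D0|] := set_0Vmem (S :\: A).
    have SiW : S :|: [set i] \in W by apply: simple_gameS SW _; apply: subsetUl.
    have := min_weak_le SiW; rewrite !profile_setU1 // iA Sa Sc !add0n add1n.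
    by rewrite -Sc D0 cards0.
  case=> j; rewrite inE => /andP[jA jS].
  have jS1 : j \notin S :\ j by rewrite !inE eqxx.
  have iS1 : i \notin S :\ j by rewrite !inE (negPf iS) andbF.
  have SE : S = (S :\ j) :|: [set j] by rewrite setUC setD1K.
  have SiW : (S :\ j) :|: [set i] \in W.
    by apply: winning_exchange => //; rewrite W_desirable iA.
  have := min_weak_le SiW; move: Sa Sc; rewrite {1 2}SE !profile_setU1 //.
  by rewrite iA jA (negPf jA) /= !add0n !add1n => -> <-.
(* A coalition that wins with [i0] but loses with [j0] exhibits the drop. *)
have : ~~ more_desirable W j0 i0 by rewrite W_desirable i0A (negPf j0A).
case/forallPn=> S; rewrite negb_imply => /andP[sub].
rewrite negb_imply => /andP[SiW SjW].
have [jS iS] : j0 \notin S /\ i0 \notin S.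
  by split; apply/negP=> /(subsetP sub); rewrite !inE eqxx ?orbT.
exists #|S :&: A|.
  apply/proper_card/properP; split; first exact: subsetIr.
  by exists i0; rewrite // inE (negPf iS).
have := min_weak_le SiW; move: SjW; rewrite {1}game_min_weak inE -ltnNge.
by rewrite !profile_setU1 // i0A (negPf j0A) /= !add0n !add1n; lia.
Qed.

End Decompose.

(** * Isomorphism invariants *)

Lemma isomorphic_desirable W W' (p : {perm T}) :
  (forall S, (S \in W) = (p @: S \in W')) ->
  forall i j, more_desirable W i j = more_desirable W' (p i) (p j).
Proof.
move=> iso i j; have imU S k : p @: S :|: [set p k] = p @: (S :|: [set k]).
  by rewrite imsetU imset_set1.
have memp S k : (p k \in p @: S) = (k \in S) by rewrite mem_imset //; apply: perm_inj.
apply/more_desirableP/more_desirableP => H S iS jS; last first.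
  by rewrite !iso -!imU; apply: H; rewrite memp.
have SE : S = p @: (p @^-1: S).
  apply/setP=> x; rewrite -[x](permKV p) memp inE permKV //.
move: iS jS; rewrite SE !memp !imU -!iso; exact: H.
Qed.

(** An isomorphism preserves desirability, hence maps strong class onto strong class and preserves
    profiles. The thresholds then compare alike with every [c <= #|~: A|], which determines them
    since neither exceeds [#|~: A|.+1]. *)
Lemma isomorphic_profile_games A A' f f' :
  0 < #|A| -> 0 < #|~: A| -> 0 < #|A'| -> 0 < #|~: A'| ->
  shift_profile #|A| #|~: A| f -> shift_profile #|A'| #|~: A'| f' ->
  isomorphic_games (profile_game A f) (profile_game A' f') ->
  #|A| = #|A'| /\ forall a, a <= #|A| -> f a = f' a.
Proof.
move=> A0 CA0 A'0 CA'0 fP f'P /existsP[p /forallP iso'].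
have iso S : (S \in profile_game A f) = (p @: S \in profile_game A' f').
  exact/eqP.
have des i j : (i \in A) || (j \notin A) = (p i \in A') || (p j \notin A').
  by have := isomorphic_desirable iso i j; rewrite !profile_game_desirable.
have pA i : (p i \in A') = (i \in A).
  apply/idP/idP => iA.
    have /card_gt0P[j jA] := A0; have := des i j.
    by rewrite iA jA orbF.
  have /card_gt0P[j jA] := A'0; have := des i (p^-1 j)%g.
  by rewrite iA permKV jA orbF.
have pAE : p @: A = A'.
  apply/setP=> x; rewrite -[x](permKV p) mem_imset ?pA //; apply: perm_inj.
have cA : #|A| = #|A'| by rewrite -pAE card_imset //; apply: perm_inj.
have cCA : #|~: A| = #|~: A'| by have := cardsC A; rewrite -(cardsC A') cA => /addnI.
split=> // a aA.
have key c : c <= #|~: A| -> (f a <= c) = (f' a <= c).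
  move=> /(exists_profile aA)[S [Sa Sc]]; have := iso S.
  rewrite !inE Sa Sc -pAE -imsetI; last by move=> ? ? _ _; apply: perm_inj.
  by rewrite -perm_imsetD !card_imset ?Sa ?Sc //; apply: perm_inj.
have := shift_profile_bound fP aA.
have := shift_profile_bound f'P; rewrite -cA -cCA => /(_ _ aA).
have := key (f a); have := key (f' a); have := key #|~: A|; rewrite !leqnn.
by move: (f a) (f' a) #|~: A| => x y z; lia.
Qed.

End ProfileGames.

(** * Canonical representatives and the final count *)

Definition initial n k : {set 'I_n} := [set i : 'I_n | i < k].

Lemma card_initial n k : k <= n -> #|initial n k| = k /\ #|~: initial n k| = n - k.
Proof.
move=> kn; suff E : #|initial n k| = k.
  by split=> //; have := cardsC (initial n k); rewrite card_ord E; lia.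
by rewrite cardsE -sum1_card -(big_ord_widen n (fun=> 1) kn) sum1_card card_ord.
Qed.

Lemma mem_profiles k b s : s \in profiles k b ->
  size s = k.+1 /\ shift_profile k b (nth 0 s).
Proof.
rewrite mem_filter mem_words => /andP[/andP[/(sortedP 0) st nt] /andP[/eqP sz /allP bd]].
split=> //; rewrite sz in st; split=> [a ak|a ak fa|].
- by have := bd (nth 0 s a); rewrite mem_nth ?sz ?ltnS // => /(_ isT).
- by have := st a; rewrite ltnS => /(_ ak); rewrite /shift_step fa.
- have : [exists a : 'I_k, (nth 0 s a.+1).+1 < nth 0 s a].
    apply: contraR nt => /existsPn nd; apply/(sortedP 0) => a; rewrite sz ltnS => ak.
    by rewrite /tight_step st //=; have := nd (Ordinal ak); rewrite -leqNgt.
  by case/existsP=> a; exists (nat_of_ord a).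
Qed.

Lemma mkseq_profiles k b f : shift_profile k b f -> mkseq f k.+1 \in profiles k b.
Proof.
case=> bd st [a ak drop]; rewrite mem_filter mem_words size_mkseq eqxx andTb.
apply/andP; split; last first.
  apply/allP=> x /mapP[c]; rewrite mem_iota add0n ltnS => /andP[_ ck] ->.
  by rewrite /= ltnS bd.
apply/andP; split.
  apply/(sortedP 0) => c; rewrite size_mkseq ltnS => ck.
  by rewrite !nth_mkseq ?ltnS // 1?ltnW //; apply/implyP; apply: st.
apply/negP=> /(sortedP 0)/(_ a); rewrite size_mkseq ltnS => /(_ ak).
by rewrite !nth_mkseq ?ltnS // 1?ltnW // => /andP[_]; lia.
Qed.

Lemma eq_profile_game (T : finType) (A : {set T}) f g :
  (forall a, a <= #|A| -> f a = g a) -> profile_game A f = profile_game A g.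
Proof.
move=> fg; apply/setP=> S; rewrite !inE fg //.
by rewrite subset_leq_card // subsetIr.
Qed.

Lemma num_two_class_gamesE n :
  num_two_class_games n = \sum_(1 <= k < n) size (profiles k (n - k)).
Proof.
(* The representative [g (k, s)] has the first [k] voters as strong class; both classes are
   nonempty, whence 0 < k < n. *)
pose L := [seq (k, s) | k <- index_iota 1 n, s <- profiles k (n - k)].
pose g (x : nat * seq nat) := profile_game (initial n x.1) (nth 0 x.2).
have LP x : x \in L -> [/\ 0 < x.1, x.1 < n, size x.2 = x.1.+1 &
    shift_profile x.1 (n - x.1) (nth 0 x.2)].
  case/allpairsPdep=> k [s [kn /mem_profiles[sz sP] ->]] /=.
  by move: kn; rewrite mem_index_iota => /andP[].
have init x : x \in L -> [/\ 0 < #|initial n x.1|, 0 < #|~: initial n x.1| &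
    shift_profile #|initial n x.1| #|~: initial n x.1| (nth 0 x.2)].
  case/LP=> x0 xn _ sP; have [-> ->] := card_initial (ltnW xn).
  by rewrite subn_gt0.
rewrite /num_two_class_games (@card_equivalence_partition _ _ _ _ L g).
- by rewrite size_allpairs_dep sumnE big_map.
- exact: isomorphic_games_equiv.
- apply: allpairs_uniq_dep => [|k _|]; first exact: iota_uniq.
    by apply: filter_uniq; apply: words_uniq.
  by move=> [k s] [k' s'] _ _ /= [-> ->].
- move=> x /init[A0 CA0 sP]; rewrite inE.
  by rewrite profile_game_complete // profile_game_two_classes.
- move=> W; rewrite inE => /andP[/andP[simp _] /two_classesP[A [A0 CA0 des]]].
  have fP := min_weak_shift simp des A0 CA0.
  have WE := game_min_weak simp des.
  have cC : #|~: A| = n - #|A| by have := cardsC A; rewrite card_ord; lia.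
  have An : #|A| < n by move: CA0; rewrite cC subn_gt0.
  exists (#|A|, mkseq (min_weak W A) #|A|.+1).
    apply/allpairsPdep; exists #|A|, (mkseq (min_weak W A) #|A|.+1); split=> //.
      by rewrite mem_index_iota A0.
    by apply: mkseq_profiles; rewrite -cC.
  (* Relabelling the voters by [p] moves the strong class to the initial segment and keeps all
     profiles. *)
  have [p pP] := exists_perm_initial A.
  apply/existsP; exists p; apply/forallP=> S; apply/eqP.
  rewrite {1}WE /g /=.
  have [iA iC] := card_initial (ltnW An).
  rewrite (@eq_profile_game _ (initial n #|A|) _ (min_weak W A)); last first.
    by move=> a; rewrite iA => aA; rewrite nth_mkseq.
  have imA : initial n #|A| = p @: A.
    apply/setP=> x; rewrite -[x](permKV p) mem_imset ?inE ?pP //; apply: perm_inj.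
  rewrite !inE imA -imsetI; last by move=> ? ? _ _; apply: perm_inj.
  by rewrite -perm_imsetD !card_imset //; apply: perm_inj.
- move=> [k s] [k' s'] xL yL iso; have [A0 CA0 sP] := init _ xL.
  have [A'0 CA'0 s'P] := init _ yL.
  have [/= _ kn sz _] := LP _ xL; have [/= _ k'n sz' _] := LP _ yL.
  have [] := isomorphic_profile_games A0 CA0 A'0 CA'0 sP s'P iso.
  have [/= -> _] := card_initial (ltnW kn); have [/= -> _] := card_initial (ltnW k'n).
  move=> kk' ss'; rewrite -kk' in sz' *; congr (_, _).
  apply: (@eq_from_nth _ 0); first by rewrite sz.
  by move=> a; rewrite sz ltnS; apply: ss'.
Qed.

Local Open Scope ring_scope.

Theorem theorem2 (n : nat) (n_gt0 : (0 < n)%N) :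
  (num_two_class_games n)%:Z =
    (fib (n + 6))%:Z - (n%:Z ^+ 2 + 4 * n%:Z + 8).
Proof.
have := sum_size_profiles n_gt0; rewrite -num_two_class_gamesE => <-.
lia.
Qed.
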